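(* Let $P(z)\in\mathbb{C}[[z]]$ with $o(P(z))\ge 2$ and let $Q_t(z)$ be its deformed inversion pair. For any $k\ge 0$ and $m\ge 1$, $$\frac{\partial}{\partial t}\Delta^kQ_t^m(z)=\frac{1}{2(m+1)}\Delta^{k+1}Q_t^{m+1}-\frac12\Delta^k\left(Q_t^m\,\Delta Q_t\right).$$
   Context: Here $z=(z_1,\dots,z_n)$, $t$ is a formal parameter commuting with $z$, $\Delta=\sum_{i=1}^n \partial^2/\partial z_i^2$, and $o(\cdot)$ denotes the order with respect to $z$ (lowest degree in $z$ of a monomial occurring). For $P\in\mathbb{C}[[z]]$ with $o(P)\ge 2$, the deformed inversion pair of $P$ is the unique $Q_t(z)\in\mathbb{C}[[z,t]]$ with $o(Q_t(z))\ge 2$ such that $z+t\nabla Q_t(z)$ is the formal (compositional, in $z$) inverse of $z-t\nabla P(z)$, where $\nabla$ is the gradient in $z$. *)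

(* Defs.v *)
From HB Require Import structures.
From mathcomp Require Import all_boot all_order all_algebra.
From mathcomp Require Import boolp.
From mathcomp Require Export reals.
From mathcomp Require Export mpoly.
From mathcomp Require Export complex.

Set Implicit Arguments.
Unset Strict Implicit.
Unset Printing Implicit Defensive.

Import GRing.Theory.
Local Open Scope ring_scope.

(* {fps K[n]} is K[[z_1, ..., z_n]]. A series is the family of its
   coefficients: f m is the coefficient of the monomial m. *)
Record fps (n : nat) (K : comNzRingType) :=
  Fps { fps_coef :> 'X_{1..n} -> K }.

Notation "{ 'fps' K [ n ] }" := (fps n K)
  (at level 0, K, n at level 2, format "{ 'fps'  K [ n ] }") : type_scope.

Lemma fpsP (n : nat) (K : comNzRingType) (f g : {fps K[n]}) :
  (forall m, f m = g m) -> f = g.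
Proof. by case: f g => f [g] /= fg; congr Fps; apply/funext. Qed.

HB.instance Definition _ (n : nat) (K : comNzRingType) :=
  gen_eqMixin {fps K[n]}.
HB.instance Definition _ (n : nat) (K : comNzRingType) :=
  gen_choiceMixin {fps K[n]}.

Section Ring.
Variables (n : nat) (K : comNzRingType).
Implicit Types (f g h : {fps K[n]}) (c : K).

Definition fps_zero : {fps K[n]} := Fps (fun _ => 0).
Definition fps_opp f : {fps K[n]} := Fps (fun m => - f m).
Definition fps_add f g : {fps K[n]} := Fps (fun m => f m + g m).
Definition fpsC c : {fps K[n]} := Fps (fun m => c *+ (m == 0%MM)).
Definition fps_scale c f : {fps K[n]} := Fps (fun m => c * f m).

(* The bound on the degrees of k.1 and k.2 only serves to make the index type
   finite: it follows from m = k.1 + k.2. *)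
Definition fps_mul f g : {fps K[n]} :=
  Fps (fun m => \sum_(k : 'X_{1..n < (mdeg m).+1, (mdeg m).+1}
                       | m == (k.1 + k.2)%MM) f k.1 * g k.2).

Fact fps_addA : associative fps_add.
Proof. by move=> f g h; apply: fpsP => m /=; rewrite addrA. Qed.
Fact fps_addC : commutative fps_add.
Proof. by move=> f g; apply: fpsP => m /=; rewrite addrC. Qed.
Fact fps_add0 : left_id fps_zero fps_add.
Proof. by move=> f; apply: fpsP => m /=; rewrite add0r. Qed.
Fact fps_addN : left_inverse fps_zero fps_opp fps_add.
Proof. by move=> f; apply: fpsP => m /=; rewrite addNr. Qed.

HB.instance Definition _ :=
  GRing.isZmodule.Build {fps K[n]} fps_addA fps_addC fps_add0 fps_addN.

(* Ring identities are transferred from {mpoly K[n]} through truncation. *)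
Definition fps_trunc (d : nat) f : {mpoly K[n]} :=
  \sum_(m : 'X_{1..n < d}) f m *: 'X_[m].

Lemma mcoeff_trunc d f m : (mdeg m < d)%N -> (fps_trunc d f)@_m = f m.
Proof. exact: mcoeff_mpoly. Qed.

Lemma fps_mulE d f g m : (mdeg m < d)%N ->
  fps_mul f g m = (fps_trunc d f * fps_trunc d g)@_m.
Proof.
move=> md; rewrite mcoeffM /=; apply: eq_bigr => k _.
by rewrite !mcoeff_trunc //; apply: leq_trans (bmdeg _) md.
Qed.

Fact fps_mulA : associative fps_mul.
Proof.
move=> f g h; apply: fpsP => m; pose d := (mdeg m).+1.
transitivity ((fps_trunc d f * (fps_trunc d g * fps_trunc d h))@_m).
  rewrite mcoeffM /=; apply: eq_bigr => k _.
  rewrite mcoeff_trunc ?bmdeg //; congr (_ * _).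
  by rewrite -fps_mulE ?bmdeg.
rewrite mulrA mcoeffM /=; apply: eq_bigr => k _.
rewrite mcoeff_trunc ?bmdeg //; congr (_ * _).
by rewrite -fps_mulE ?bmdeg.
Qed.

Fact fps_mulC : commutative fps_mul.
Proof.
move=> f g; apply: fpsP => m.
by rewrite !(@fps_mulE (mdeg m).+1) // mulrC.
Qed.

Fact fps_mul1 : left_id (fpsC 1) fps_mul.
Proof.
move=> f; apply: fpsP => m; set d := (mdeg m).+1.
rewrite -[RHS](@mcoeff_trunc d) // -[X in X@__]mul1r mcoeffM /=.
apply: eq_bigr => k _.
by rewrite mcoeff1 mcoeff_trunc ?bmdeg.
Qed.

Fact fps_mulDl : left_distributive fps_mul +%R.
Proof.
move=> f g h; apply: fpsP => m /=; rewrite -big_split /=.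
by apply: eq_bigr => k _; rewrite mulrDl.
Qed.

Fact fps_oner_neq0 : fpsC 1 != 0.
Proof.
apply/eqP => /(congr1 (fun f : {fps K[n]} => f 0%MM)) /= /eqP.
by rewrite eqxx oner_eq0.
Qed.

HB.instance Definition _ :=
  GRing.Zmodule_isComNzRing.Build {fps K[n]}
    fps_mulA fps_mulC fps_mul1 fps_mulDl fps_oner_neq0.

Fact fps_scaleA c1 c2 f :
  fps_scale c1 (fps_scale c2 f) = fps_scale (c1 * c2) f.
Proof. by apply: fpsP => m /=; rewrite mulrA. Qed.
Fact fps_scale1 : left_id 1 fps_scale.
Proof. by move=> f; apply: fpsP => m /=; rewrite mul1r. Qed.
Fact fps_scaleDr : right_distributive fps_scale +%R.
Proof. by move=> c f g; apply: fpsP => m /=; rewrite mulrDr. Qed.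
Fact fps_scaleDl f : {morph fps_scale^~ f : a b / a + b}.
Proof. by move=> a b; apply: fpsP => m /=; rewrite mulrDl. Qed.

HB.instance Definition _ :=
  GRing.Zmodule_isLmodule.Build K {fps K[n]}
    fps_scaleA fps_scale1 fps_scaleDr fps_scaleDl.

Fact fps_scaleAl c f g : c *: (f * g) = (c *: f) * g.
Proof.
apply: fpsP => m /=; rewrite mulr_sumr.
by apply: eq_bigr => k _ /=; rewrite mulrA.
Qed.

HB.instance Definition _ :=
  GRing.Lmodule_isLalgebra.Build K {fps K[n]} fps_scaleAl.
HB.instance Definition _ := GRing.Lalgebra_isComAlgebra.Build K {fps K[n]}.

End Ring.

Notation "c %:FS" := (fpsC _ c)
  (at level 2, left associativity, format "c %:FS") : ring_scope.

Definition fpsX (n : nat) (K : comNzRingType) (i : 'I_n) : {fps K[n]} :=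
  Fps (fun m => (m == U_(i)%MM)%:R).

Definition fps_map (n : nat) (K L : comNzRingType) (phi : K -> L)
    (f : {fps K[n]}) : {fps L[n]} := Fps (fun m => phi (f m)).

(* o(f) >= d, where o(f) is the lowest degree of a monomial occurring in f,
   and o(0) is infinite. *)
Definition order_ge (n : nat) (K : comNzRingType) (d : nat)
    (f : {fps K[n]}) : Prop :=
  forall m : 'X_{1..n}, f m != 0 -> (d <= mdeg m)%N.

Definition fps_deriv (n : nat) (K : comNzRingType) (i : 'I_n)
    (f : {fps K[n]}) : {fps K[n]} :=
  Fps (fun m => f (m + U_(i))%MM *+ (m i).+1).

Definition gradient (n : nat) (K : comNzRingType) (f : {fps K[n]}) :
    'I_n -> {fps K[n]} := fun i => fps_deriv i f.

Definition laplacian (n : nat) (K : comNzRingType) (f : {fps K[n]}) :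
    {fps K[n]} := \sum_(i < n) fps_deriv i (fps_deriv i f).

(* The substitution f(g_1, ..., g_n), for series g_i with zero constant term
   (order_ge 1): then g^b has order at least |b|, so that only the
   exponents b with |b| <= |m| contribute to the coefficient of m. *)
Definition fps_subst (n p : nat) (K : comNzRingType) (f : {fps K[n]})
    (g : 'I_n -> {fps K[p]}) : {fps K[p]} :=
  Fps (fun m => \sum_(b : 'X_{1..n < (mdeg m).+1})
                  f b * (\prod_(i < n) g i ^+ b i) m).

Definition formal_inverse (n : nat) (K : comNzRingType)
    (F G : 'I_n -> {fps K[n]}) : Prop :=
  [/\ forall i, order_ge 1 (F i),
      forall i, order_ge 1 (G i),
      forall i, fps_subst (F i) G = fpsX K i
    & forall i, fps_subst (G i) F = fpsX K i].

(* C[[z, t]] is C[[t]][[z]]: order_ge, the gradient, the Laplacian and the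
   substitution over the base ring C[[t]] are then those with respect to z. *)
Notation "{ 'fpst' K [ n ] }" := {fps {fps K[1]}[n]}
  (at level 0, K, n at level 2, format "{ 'fpst'  K [ n ] }") : type_scope.

Definition fpst_t (n : nat) (K : comNzRingType) : {fpst K[n]} :=
  (fpsX K (ord0 : 'I_1))%:FS.

Definition fpst_of_fps (n : nat) (K : comNzRingType) (f : {fps K[n]}) :
    {fpst K[n]} := fps_map (fun c => c%:FS) f.

Definition fpst_deriv_t (n : nat) (K : comNzRingType) (f : {fpst K[n]}) :
    {fpst K[n]} := fps_map (fps_deriv ord0) f.

Definition deformed_inversion_pair (n : nat) (K : comNzRingType)
    (P : {fps K[n]}) (Q : {fpst K[n]}) : Prop :=
  order_ge 2 Q /\
  formal_inverse
    (fun i => fpsX _ i - fpst_t n K * gradient (fpst_of_fps P) i)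
    (fun i => fpsX _ i + fpst_t n K * gradient Q i).

(* Main.v *)
From HB Require Import structures.
Require Import Defs.
From mathcomp Require Import all_boot all_order all_algebra.

(* Put N = grad Q and G = z + t N. Cancelling t in G - t (grad P)(G) = z gives
   N = (grad P)(G). Differentiating this in t and in z, with H = (Hess P)(G),
   the difference E = dN/dt - (DN) N satisfies E = t H E, so that E is divisible
   by every power of t and vanishes. As DN is symmetric, this says that
   grad (2 dQ/dt - |grad Q|^2) = 0, and comparing constant terms
   2 dQ/dt = |grad Q|^2. The claim for k = 0 is then the product rule
   applied to the Laplacian of Q^(m+1); and d/dt commutes with the Laplacian. *)

Import GRing.Theory.
Local Open Scope ring_scope.
Local Open Scope complex_scope.

Set Implicit Arguments.
Unset Strict Implicit.

(** * Coefficients and products of formal power series *)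

Section PowerSeries.
Variables (n : nat) (K : comNzRingType).
Implicit Types (f g h : {fps K[n]}) (p q : {mpoly K[n]}) (m : 'X_{1..n}).

Lemma fps_coefD f g m : (f + g) m = f m + g m. Proof. by []. Qed.
Lemma fps_coefB f g m : (f - g) m = f m - g m. Proof. by []. Qed.

Lemma fps_coef_sum (I : Type) (r : seq I) (P : pred I) (F : I -> {fps K[n]}) m :
  (\sum_(i <- r | P i) F i) m = \sum_(i <- r | P i) F i m.
Proof. by elim/big_rec2: _ => // i x y _ <-. Qed.

Lemma fps_coefMn f m k : (f *+ k) m = f m *+ k.
Proof. by elim: k => // k IH; rewrite !mulrS -IH. Qed.

Lemma fps_coefM f g m :
  (f * g) m = \sum_(k : 'X_{1..n < (mdeg m).+1, (mdeg m).+1}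
                       | m == (k.1 + k.2)%MM) f k.1 * g k.2.
Proof. by []. Qed.

Lemma fps_coefM_local f g f' g' m :
  (forall k, (mdeg k <= mdeg m)%N -> f k = f' k) ->
  (forall k, (mdeg k <= mdeg m)%N -> g k = g' k) ->
  (f * g) m = (f' * g') m.
Proof.
by move=> ff gg; apply: eq_bigr => k _; rewrite ff ?gg // -ltnS bmdeg.
Qed.

(** A coefficient of degree d in a product involves only factors of degree at most d. Polynomials
    can thus stand in for the series, and identities such as the Leibniz rule carry over from
    [{mpoly K[n]}]. *)
Lemma fps_coefM_mpoly f g p q m :
  (forall k, (mdeg k <= mdeg m)%N -> f k = p@_k) ->
  (forall k, (mdeg k <= mdeg m)%N -> g k = q@_k) ->
  (f * g) m = (p * q)@_m.
Proof.
move=> fp gq; rewrite mcoeffM; apply: eq_bigr => k _.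
by rewrite fp ?gq // -ltnS bmdeg.
Qed.

Lemma fpsC_is_zmod_morphism : zmod_morphism (@fpsC n K).
Proof. by move=> a b; apply: fpsP => m /=; rewrite mulrnBl. Qed.

Lemma fpsCE c : c%:FS = c%:A :> {fps K[n]}.
Proof.
apply: fpsP => m; change (c *+ (m == 0%MM) = c * (1 *+ (m == 0%MM))).
by case: (m == _); rewrite ?mulr1 ?mulr0.
Qed.

Lemma fpsC_is_monoid_morphism : monoid_morphism (@fpsC n K).
Proof. by split=> [//|a b]; rewrite !fpsCE mulr_algl scalerA. Qed.

HB.instance Definition _ := GRing.isZmodMorphism.Build K {fps K[n]}
  (@fpsC n K) fpsC_is_zmod_morphism.
HB.instance Definition _ := GRing.isMonoidMorphism.Build K {fps K[n]}
  (@fpsC n K) fpsC_is_monoid_morphism.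

Lemma fpsCM_coef c f m : (c%:FS * f) m = c * f m.
Proof. by rewrite fpsCE mulr_algl. Qed.

Lemma fpsXM_coef (i : 'I_n) f m : (fpsX K i * f) (m + U_(i))%MM = f m.
Proof.
rewrite (@fps_coefM_mpoly _ _ 'X_i (fps_trunc (mdeg m).+2 f)).
- by rewrite mulrC addmC mcoeffMX mcoeff_trunc.
- by move=> k _; rewrite mcoeffX eq_sym.
- by move=> k; rewrite mdegD mdeg1 addn1 => kd; rewrite mcoeff_trunc.
Qed.

Lemma fpsX_mulI (i : 'I_n) : GRing.lreg (fpsX K i).
Proof.
by move=> f g e; apply: fpsP => m; rewrite -(fpsXM_coef i f) e fpsXM_coef.
Qed.

(** * Order of a series *)

Lemma order_ge_coef0 d f m : order_ge d f -> (mdeg m < d)%N -> f m = 0.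
Proof.
by move=> fd md; apply/eqP; apply: contraTT md => /fd; rewrite -leqNgt.
Qed.

Lemma order_ge_sum d (I : Type) (r : seq I) (P : pred I)
    (F : I -> {fps K[n]}) :
  (forall i, P i -> order_ge d (F i)) -> order_ge d (\sum_(i <- r | P i) F i).
Proof.
move=> Fd m; rewrite leqNgt; apply: contraNN => md; apply/eqP.
by rewrite fps_coef_sum big1 // => i /Fd Fi; apply: order_ge_coef0 md.
Qed.

Lemma order_geM a b f g :
  order_ge a f -> order_ge b g -> order_ge (a + b) (f * g).
Proof.
move=> fa gb m; rewrite leqNgt; apply: contraNN => md; apply/eqP.
rewrite fps_coefM big1 // => k /eqP mk.
have [ka|ka] := ltnP (mdeg k.1) a; first by rewrite (order_ge_coef0 fa) ?mul0r.
rewrite [g _](order_ge_coef0 gb) ?mulr0 //.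
have mE : (mdeg k.1 + mdeg k.2)%N = mdeg m by rewrite -mdegD -mk.
apply: contraTT md; rewrite -!leqNgt => kb.
by have := leq_add ka kb; rewrite mE.
Qed.

Lemma order_geX d f k : order_ge d f -> order_ge (d * k) (f ^+ k).
Proof.
move=> fd; elim: k => [|k IH]; first by rewrite muln0.
by rewrite mulnS exprS; apply: order_geM.
Qed.

Lemma order_ge_prod (I : Type) (r : seq I) (d : I -> nat)
    (F : I -> {fps K[n]}) :
  (forall i, order_ge (d i) (F i)) ->
  order_ge (\sum_(i <- r) d i) (\prod_(i <- r) F i).
Proof.
by move=> Fd; elim/big_rec2: _ => // i a f _; apply: order_geM.
Qed.

Lemma order_ge_fpsX (i : 'I_n) : order_ge 1 (fpsX K i).
Proof.
by move=> m /=; case: (m =P U_(i)%MM) => [->|_]; rewrite ?mdeg1 ?eqxx.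
Qed.

Lemma order_ge_all0 f : (forall d, order_ge d f) -> f = 0.
Proof.
by move=> fd; apply: fpsP => m; apply: order_ge_coef0 (fd (mdeg m).+1) _.
Qed.

(** * Partial derivatives and the Laplacian *)

Lemma fps_deriv_is_linear i : linear (@fps_deriv n K i).
Proof.
move=> c f g; apply: fpsP => m /=.
by rewrite mulrnDl -mulrnAr.
Qed.

HB.instance Definition _ i :=
  GRing.isLinear.Build K {fps K[n]} {fps K[n]} *:%R (@fps_deriv n K i)
    (fps_deriv_is_linear i).

Lemma mcoeff_fps_trunc d f m :
  (fps_trunc d f)@_m = if (mdeg m < d)%N then f m else 0.
Proof.
case: ifPn => [|md]; first exact: mcoeff_trunc.
rewrite raddf_sum big1 //= => k _; rewrite mcoeffZ mcoeffX.
by have [km|_] := eqVneq; [rewrite -km bmdeg in md | rewrite mulr0].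
Qed.

Lemma fps_trunc_X d (i : 'I_n) :
  fps_trunc d.+2 (fpsX K i) = 'X_i.
Proof.
apply/mpolyP => m; rewrite mcoeff_fps_trunc mcoeffX /= eq_sym.
by have [<-|_] := eqVneq; rewrite ?mdeg1 // if_same.
Qed.

Lemma fps_deriv_trunc i d f :
  (fps_trunc d.+1 f)^`M(i) = fps_trunc d (fps_deriv i f).
Proof.
apply/mpolyP => m; rewrite mcoeff_deriv !mcoeff_fps_trunc.
rewrite mdegD mdeg1 addn1 ltnS.
by case: ifP => //; rewrite mul0rn.
Qed.

Lemma fps_derivM i f g :
  fps_deriv i (f * g) = fps_deriv i f * g + f * fps_deriv i g.
Proof.
(* The coefficient of [m] in a derivative reads degree [mdeg m + 1], and a truncation at [d] keeps
   the degrees strictly below [d]. *)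
apply: fpsP => m; set d := (mdeg m).+2.
have trunc_agree e h k : (mdeg m < e)%N -> (mdeg k <= mdeg m)%N ->
    h k = (fps_trunc e h)@_k.
  by move=> me km; rewrite mcoeff_trunc // (leq_ltn_trans km).
transitivity ((fps_trunc d f * fps_trunc d g)^`M(i)@_m).
  rewrite mcoeff_deriv /=; congr (_ *+ _).
  by apply: fps_coefM_mpoly => k; rewrite mdegD mdeg1 addn1 => km;
     rewrite mcoeff_trunc.
rewrite mderivM mcoeffD fps_coefD !fps_deriv_trunc.
congr (_ + _); symmetry; apply: fps_coefM_mpoly => k; exact: trunc_agree.
Qed.

Lemma fps_deriv_comm i j f :
  fps_deriv i (fps_deriv j f) = fps_deriv j (fps_deriv i f).
Proof.
apply: fpsP => m /=; rewrite !mnmDE !mnm1E -!addmA [(U_(i) + _)%MM]addmC.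
by case: eqVneq => [->//|ij]; rewrite !addn0 mulrnAC.
Qed.

Lemma fps_map_id f : fps_map idfun f = f. Proof. exact: fpsP. Qed.

Lemma fps_derivC i c : fps_deriv i c%:FS = 0 :> {fps K[n]}.
Proof. by apply: fpsP => m /=; rewrite mnmD_eq0 mnm1_eq0 andbF mul0rn. Qed.

Lemma fps_derivX (i j : 'I_n) : fps_deriv i (fpsX K j) = (i == j)%:R.
Proof.
apply: fpsP => m /=; have [<-|ij] := eqVneq i j.
  have -> : (m + U_(i) == U_(i))%MM = (m == 0%MM).
    by rewrite -[X in _ == X]add0m eqm_add2r.
  change ((m == 0%MM)%:R *+ (m i).+1 = 1 *+ (m == 0%MM) :> K).
  by case: eqP => [->|_]; rewrite ?mnm0E ?mul0rn.
case: eqP => [/mnmP /(_ i)|_]; last by rewrite mul0rn.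
by rewrite mnmDE !mnm1E eqxx eq_sym (negbTE ij) addn1.
Qed.

Lemma order_ge_deriv i d f : order_ge d.+1 f -> order_ge d (fps_deriv i f).
Proof.
move=> fd m; apply: contraNT; rewrite -ltnNge /= => md.
by rewrite (order_ge_coef0 fd) ?mul0rn // mdegD mdeg1 addn1 ltnS.
Qed.

(** For nonzero [m], choose [i] with [m i > 0]: the coefficient of [m - U_(i)] in the i-th
    derivative is [m i] times that of [m] in [f]. The first hypothesis says that K has no additive
    torsion, so the latter is zero. *)
Lemma fps_deriv_eq0 f :
  (forall (x : K) k, x *+ k.+1 = 0 -> x = 0) ->
  (forall i, fps_deriv i f = 0) -> f 0%MM = 0 -> f = 0.
Proof.
move=> K0 f0 f00; apply: fpsP => m.
have [->//|/existsP [i mi]] : m = 0%MM \/ [exists i, m i != 0%N].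
  have [e|/existsPn e] := boolP [exists i, m i != 0%N]; [by right|left].
  by apply/mnmP => i; rewrite mnm0E; apply/eqP; move: (e i); rewrite negbK.
have Um : (U_(i) <= m)%MM by rewrite lep1mP.
rewrite -(submK Um); apply: (K0 _ ((m - U_(i))%MM i)).
by have /(congr1 (fun g : {fps K[n]} => g (m - U_(i))%MM)) := f0 i.
Qed.

Lemma laplacian_is_linear : linear (@laplacian n K).
Proof.
move=> c f g; rewrite /laplacian scaler_sumr -big_split /=.
by apply: eq_bigr => i _; rewrite !linearP.
Qed.

HB.instance Definition _ :=
  GRing.isLinear.Build K {fps K[n]} {fps K[n]} *:%R (@laplacian n K)
    laplacian_is_linear.

Lemma iter_laplacianB k c d f g :
  iter k (@laplacian n K) (c *: f - d *: g) =
  c *: iter k (@laplacian n K) f - d *: iter k (@laplacian n K) g.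
Proof. by elim: k => //= k ->; rewrite linearB !linearZ. Qed.

End PowerSeries.

(** * Derivations of a commutative ring and the polynomial chain rule *)

Section Derivation.
Variables (A : comNzRingType) (D : {additive A -> A}).
Hypothesis DM : forall x y, D (x * y) = D x * y + x * D y.

Lemma derivation1 : D 1 = 0.
Proof.
apply: (addrI (D 1)); rewrite addr0 -[RHS](congr1 D (mulr1 1)) DM.
by rewrite mulr1 mul1r.
Qed.

Lemma derivationX x k : D (x ^+ k.+1) = (x ^+ k * D x) *+ k.+1.
Proof.
elim: k => [|k IH]; first by rewrite !expr1 expr0 mul1r.
rewrite exprS DM IH [D x * _]mulrC mulrnAr mulrA -exprS.
by rewrite [RHS]mulrS.
Qed.

Variables (K : comNzRingType) (n : nat) (phi : {rmorphism K -> A}).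
Variable g : 'I_n -> A.
Hypothesis Dphi : forall c, D (phi c) = 0.

Let chain (p : {mpoly K[n]}) :=
  D (mmap phi g p) = \sum_(j < n) mmap phi g p^`M(j) * D (g j).

(** The formula holds for variables and for constants, which [D] kills through [phi]. It is stable
    under products and sums, hence holds for all polynomials. *)
Lemma mmap_chain p : chain p.
Proof.
have chain1 : chain 1.
  rewrite /chain rmorph1 derivation1 big1 // => j _.
  by rewrite -[1]/(1%:MP) mderivC raddf0 mul0r.
have chainM p1 p2 : chain p1 -> chain p2 -> chain (p1 * p2).
  rewrite /chain rmorphM DM => -> ->.
  rewrite mulr_suml mulr_sumr -big_split /=; apply: eq_bigr => j _.
  by rewrite mderivM raddfD /= !rmorphM /= mulrDl mulrAC -!mulrA.
have chainU i : chain 'X_i.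
  rewrite /chain mmapX mmap1U (bigD1 i) //= big1 => [|j ji].
    rewrite addr0 mderivX mnm1E eqxx scale1r -[X in (X - _)%MM]add0m addmK.
    by rewrite mpolyX0 rmorph1 mul1r.
  by rewrite mderivX mnm1E eq_sym (negbTE ji) scale0r raddf0 mul0r.
have chainX m : chain 'X_[m].
  rewrite mpolyXE_id; elim/big_rec: _ => // i p1 _; apply: (chainM).
  elim: (m i) => // k IH; rewrite exprS; exact: chainM.
have chainC c : chain c%:MP.
  rewrite /chain mmapC Dphi big1 // => j _.
  by rewrite mderivC raddf0 mul0r.
elim/mpolyind: p => [|c m p _ _ IH]; first by rewrite -mpolyC0.
rewrite /chain !raddfD /= IH -mul_mpolyC (chainM _ _ (chainC c)) //.
rewrite -big_split /=.
by apply: eq_bigr => j _; rewrite -mulrDl -raddfD -mderivD.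
Qed.

End Derivation.

(** * The chain rule for substitution into power series *)

Section ChainRule.
Variables (n p : nat) (K L : comNzRingType) (phi : {rmorphism K -> L}).
Variable g : 'I_n -> {fps L[p]}.
Hypothesis g1 : forall i, order_ge 1 (g i).
Implicit Types (f : {fps K[n]}) (h : {fps L[p]}).

Let C : {rmorphism K -> {fps L[p]}} := (@fpsC p L \o phi).

Let CM_coef c h m : (C c * h) m = phi c * h m.
Proof. exact: fpsCM_coef. Qed.

Lemma order_ge_mmap1 (b : 'X_{1..n}) : order_ge (mdeg b) (mmap1 g b).
Proof.
rewrite mdegE; apply: order_ge_prod => i.
by rewrite -[X in order_ge X](mul1n (b i)); apply: order_geX.
Qed.

(** The terms of [f] of degree above [mdeg m] contribute nothing, because [g^b] has order at least
    [mdeg b]. Leaving [d] free allows one truncation to serve all degrees below it. *)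
Lemma fps_subst_trunc f d m : (mdeg m < d)%N ->
  fps_subst (fps_map phi f) g m = mmap C g (fps_trunc d f) m.
Proof.
move=> md.
have -> : mmap C g (fps_trunc d f) m
          = mmap C g (fps_trunc (mdeg m).+1 f) m.
  apply/eqP; rewrite -subr_eq0 -fps_coefB -raddfB; apply/eqP.
  rewrite /mmap fps_coef_sum big1_seq // => b _; rewrite CM_coef.
  have [bm|mb] := leqP (mdeg b) (mdeg m).
    rewrite mcoeffB !mcoeff_trunc ?(leq_ltn_trans bm) //.
    by rewrite subrr rmorph0 mul0r.
  by rewrite (order_ge_coef0 (order_ge_mmap1 (b := b))) ?mulr0.
rewrite raddf_sum fps_coef_sum; apply: eq_bigr => b _.
by rewrite -[RHS]/(mmap C g (f b *: 'X_[b]) m) mmapZ mmapX CM_coef.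
Qed.

Variable D : {additive {fps L[p]} -> {fps L[p]}}.
Hypothesis DM : forall x y, D (x * y) = D x * y + x * D y.
Hypothesis DC : forall c, D (C c) = 0.
(* A continuity assumption, which reduces the chain rule to polynomials. The
   shift of the degree by one allows for D = d/dz_i, and d/dt needs none. *)
Hypothesis D_local : forall h h' (m : 'X_{1..p}),
  (forall k, (mdeg k <= (mdeg m).+1)%N -> h k = h' k) -> D h m = D h' m.

(** At a fixed monomial [f] may be truncated, and the polynomial rule applies. Keeping [D] abstract
    gives both the z-derivatives and d/dt; [phi] will embed K into K[[t]] as the constants in t. *)
Lemma fps_subst_chain f :
  D (fps_subst (fps_map phi f) g) =
  \sum_(j < n) fps_subst (fps_map phi (fps_deriv j f)) g * D (g j).
Proof.
apply: fpsP => m.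
rewrite (@D_local _ (mmap C g (fps_trunc (mdeg m).+2 f))); last first.
  by move=> k km; apply: fps_subst_trunc.
rewrite mmap_chain // !fps_coef_sum; apply: eq_bigr => j _.
rewrite fps_deriv_trunc; apply: fps_coefM_local => // k km.
by rewrite -fps_subst_trunc.
Qed.

End ChainRule.

(** * Linearity of substitution, and substitution into a variable *)

Section Subst.
Variables (n p : nat) (K : comNzRingType) (g : 'I_n -> {fps K[p]}).
Hypothesis g1 : forall i, order_ge 1 (g i).

Lemma fps_substB f h : fps_subst (f - h) g = fps_subst f g - fps_subst h g.
Proof.
apply: fpsP => m; rewrite fps_coefB -sumrB.
by apply: eq_bigr => b _; rewrite -mulrBl.
Qed.

Lemma fps_substZ c f : fps_subst (c *: f) g = c *: fps_subst f g.
Proof.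
apply: fpsP => m; change (fps_subst (c *: f) g m = c * fps_subst f g m).
by rewrite mulr_sumr; apply: eq_bigr => b _; rewrite mulrA.
Qed.

Lemma fps_substX i : fps_subst (fpsX K i) g = g i.
Proof.
apply: fpsP => m; rewrite -(fps_map_id (fpsX K i)).
rewrite (@fps_subst_trunc _ _ _ _ idfun _ g1 _ (mdeg m).+2) // fps_trunc_X.
by rewrite mmapX mmap1U.
Qed.

End Subst.

(** * The parameter t: cancellation, differentiation and t-adic uniqueness *)

Section DeformationParameter.
Variables (n : nat) (K : comNzRingType).
Implicit Types (f g : {fpst K[n]}).
Local Notation t := (fpst_t n K).
Local Notation dt := (@fpst_deriv_t n K).

Lemma fpst_tM_coef f (m : 'X_{1..n}) : (t * f) m = fpsX K ord0 * f m.
Proof. exact: fpsCM_coef. Qed.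

Lemma fpst_t_mulI : GRing.lreg t.
Proof.
move=> f g e; apply: fpsP => m; apply: (@fpsX_mulI _ _ ord0).
by rewrite -!fpst_tM_coef e.
Qed.

Lemma fpst_deriv_t_is_zmod_morphism : zmod_morphism dt.
Proof. by move=> f g; apply: fpsP => m; exact: raddfB. Qed.

HB.instance Definition _ :=
  GRing.isZmodMorphism.Build {fpst K[n]} {fpst K[n]} dt
    fpst_deriv_t_is_zmod_morphism.

Lemma fpst_deriv_tM f g : dt (f * g) = dt f * g + f * dt g.
Proof.
apply: fpsP => m; rewrite fps_coefD !fps_coefM -big_split /=.
rewrite -[LHS]/(fps_deriv ord0 ((f * g) m)) fps_coefM raddf_sum.
apply: eq_bigr => k _; exact: fps_derivM.
Qed.

Lemma fpst_deriv_t_comm i f : dt (fps_deriv i f) = fps_deriv i (dt f).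
Proof. by apply: fpsP => m; exact: raddfMn. Qed.

Lemma fpst_deriv_t_laplacian f : dt (laplacian f) = laplacian (dt f).
Proof.
rewrite raddf_sum; apply: eq_bigr => i _ /=.
by rewrite !fpst_deriv_t_comm.
Qed.

Lemma fpst_deriv_t_iter_laplacian k f :
  dt (iter k (@laplacian n _) f) = iter k (@laplacian n _) (dt f).
Proof. by elim: k => //= k <-; rewrite fpst_deriv_t_laplacian. Qed.

Lemma fpst_deriv_t_C (c : {fps K[1]}) : dt c%:FS = (fps_deriv ord0 c)%:FS.
Proof. by apply: fpsP => m; exact: raddfMn. Qed.

Lemma fpst_deriv_t_t : dt t = 1.
Proof. by rewrite fpst_deriv_t_C fps_derivX eqxx. Qed.

Lemma fpst_deriv_t_X i : dt (fpsX _ i) = 0.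
Proof.
by apply: fpsP => m /=; case: eqP => _; rewrite ?raddf0 // (@fps_derivC 1).
Qed.

(** Divisibility by a power of t is measured by the order in t of each z-coefficient: the factor t
    raises it by one and multiplication by [H] does not lower it. *)
Lemma fpst_tM_fixpoint (H : 'I_n -> 'I_n -> {fpst K[n]})
    (E : 'I_n -> {fpst K[n]}) :
  (forall i, E i = \sum_(j < n) H i j * (t * E j)) -> forall i, E i = 0.
Proof.
move=> EE i; apply: fpsP => m; apply: order_ge_all0 => d.
(* The induction covers all components and monomials at once, since the sum over j and the product
   with [H] mix them. *)
elim: d i m => [//|d IH] i m; rewrite EE fps_coef_sum.
apply: order_ge_sum => j _; rewrite mulrCA fpst_tM_coef.
apply: (@order_geM _ _ 1 d); first exact: order_ge_fpsX.
rewrite fps_coefM; apply: order_ge_sum => k _.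
exact: (@order_geM _ _ 0 d).
Qed.

(** * Differential equations satisfied by the deformed inversion pair *)

Section InversionPair.
Variables (P : {fps K[n]}) (Q : {fpst K[n]}).
Hypothesis hQ : deformed_inversion_pair P Q.

Let G i : {fpst K[n]} := fpsX _ i + t * fps_deriv i Q.
Let S (f : {fps K[n]}) : {fpst K[n]} := fps_subst (fpst_of_fps f) G.

Lemma inversion_pair_gradient i : fps_deriv i Q = S (fps_deriv i P).
Proof.
have [_ [_ G1 FG _]] := hQ.
have := FG i; rewrite fps_substB fps_substX //.
(* As t is a scalar of the base ring K[[t]], linearity of the substitution is enough to pull it out;
   multiplicativity is avoided. *)
have -> : t * gradient (fpst_of_fps P) i
    = (fpsX K ord0 : {fps K[1]}) *: fpst_of_fps (fps_deriv i P).
  rewrite /fpst_t fpsCE mulr_algl; congr (_ *: _).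
  by apply: fpsP => m /=; rewrite raddfMn.
rewrite fps_substZ => /(canRL (subrK _)) /addrI.
rewrite -[X in _ = X]mulr_algl -fpsCE; exact: fpst_t_mulI.
Qed.

(** This is the inviscid Burgers equation for N = grad Q. Both dN/dt and (DN) N solve X = H (N + t
    X), which has only one solution by [fpst_tM_fixpoint]. *)
Lemma inversion_pair_burgers i :
  dt (fps_deriv i Q) = \sum_(k < n) fps_deriv k (fps_deriv i Q) * fps_deriv k Q.
Proof.
have [_ [_ G1 _ _]] := hQ.
pose N j := fps_deriv j Q; pose H i j := S (fps_deriv j (fps_deriv i P)).
(* The last factor is the t-derivative of [G l]; in [dN] below it is the z-derivative, where z
   contributes a Kronecker delta. *)
have dtN j : dt (N j) = \sum_(l < n) H j l * (N l + t * dt (N l)).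
  rewrite {1}/N inversion_pair_gradient (fps_subst_chain G1 fpst_deriv_tM).
  - apply: eq_bigr => l _; congr (_ * _).
    rewrite raddfD /= fpst_deriv_t_X add0r fpst_deriv_tM fpst_deriv_t_t.
    by rewrite mul1r.
  - by move=> c; rewrite /= fpst_deriv_t_C fps_derivC raddf0.
  - by move=> f h m fh /=; rewrite fh.
have dN j k : fps_deriv k (N j)
    = \sum_(l < n) H j l * ((k == l)%:R + t * fps_deriv k (N l)).
  rewrite {1}/N inversion_pair_gradient (fps_subst_chain G1 (fps_derivM k)).
  - apply: eq_bigr => l _; congr (_ * _).
    by rewrite raddfD /= fps_derivX fps_derivM fps_derivC mul0r add0r.
  - by move=> c; rewrite /= fps_derivC.
  - by move=> f h m fh /=; rewrite fh // mdegD mdeg1 addn1.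
have convection j : \sum_(k < n) fps_deriv k (N j) * N k
    = \sum_(l < n) H j l * (N l + t * \sum_(k < n) fps_deriv k (N l) * N k).
  under eq_bigr => k _ do rewrite dN mulr_suml.
  rewrite exchange_big; apply: eq_bigr => l _ /=.
  under eq_bigr => k _ do rewrite -mulrA mulrDl -mulrA.
  rewrite -mulr_sumr big_split -mulr_sumr /=; congr (_ * (_ + _)).
  rewrite (bigD1 l) //= eqxx mul1r big1 ?addr0 // => k /negbTE ->.
  by rewrite mul0r.
pose E j := dt (N j) - \sum_(k < n) fps_deriv k (N j) * N k.
suff /(_ i) /eqP : forall j, E j = 0 by rewrite subr_eq0 => /eqP.
apply: (@fpst_tM_fixpoint H) => j; rewrite {1}/E dtN convection -sumrB.
apply: eq_bigr => l _; rewrite -mulrBr; congr (_ * _).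
by rewrite opprD addrACA subrr add0r -mulrBr.
Qed.

Lemma inversion_pair_hamilton_jacobi :
  (forall (x : K) k, x *+ k.+1 = 0 -> x = 0) ->
  dt Q *+ 2 = \sum_(j < n) fps_deriv j Q ^+ 2.
Proof.
move=> K0; have [Q2 _] := hQ.
apply/eqP; rewrite -subr_eq0; apply/eqP; apply: fps_deriv_eq0 => [x k xk|i|].
(* The coefficient ring is here K[[t]], which inherits the absence of torsion from K
   coefficientwise. *)
- apply: fpsP => m; apply: (K0 _ k).
  by rewrite -fps_coefMn xk.
(* The symmetry of the Hessian of Q identifies half the i-th derivative of the squared gradient with
   the Burgers term. *)
- rewrite raddfB raddfMn raddf_sum /= -fpst_deriv_t_comm inversion_pair_burgers.
  rewrite -sumrMnl -sumrB big1 // => j _.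
  rewrite expr2 fps_derivM (fps_deriv_comm i j) [fps_deriv j Q * _]mulrC.
  by rewrite -mulr2n subrr.
(* Both constant terms in z vanish: Q has order at least 2, and so have the squares of its first
   derivatives. *)
- have Q1 j : order_ge 1 (fps_deriv j Q) by apply: order_ge_deriv.
  rewrite fps_coefB fps_coefMn /= (order_ge_coef0 Q2) ?mdeg0 // raddf0 mul0rn.
  rewrite (@order_ge_coef0 _ _ 2) ?mdeg0 ?subr0 //.
  by apply: order_ge_sum => j _; apply: (@order_geX _ _ 1 _ 2).
Qed.

(** The product rule yields the gradient term m Q^(m-1) |grad Q|^2, which the Hamilton-Jacobi
    equation turns into 2 d(Q^m)/dt. Written this way, the formula also makes sense for m = 0. *)
Lemma laplacianX m :
  (forall (x : K) k, x *+ k.+1 = 0 -> x = 0) ->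
  laplacian (Q ^+ m.+1) = (Q ^+ m * laplacian Q + dt (Q ^+ m) *+ 2) *+ m.+1.
Proof.
move=> K0.
have DX i k : fps_deriv i (Q ^+ k.+1) = (Q ^+ k * fps_deriv i Q) *+ k.+1.
  exact: (derivationX (fps_derivM i)).
rewrite /laplacian (eq_bigr (fun i => (Q ^+ m * fps_deriv i (fps_deriv i Q)
    + fps_deriv i (Q ^+ m) * fps_deriv i Q) *+ m.+1)); last first.
  by move=> i _; rewrite DX raddfMn /= fps_derivM addrC.
rewrite sumrMnl big_split /= -mulr_sumr; congr ((_ + _) *+ _).
case: m => [|m].
  rewrite expr0 (derivation1 fpst_deriv_tM) mul0rn big1 // => i _.
  by rewrite (derivation1 (fps_derivM i)) mul0r.
rewrite (derivationX fpst_deriv_tM) mulrnAC -mulrnAr.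
rewrite inversion_pair_hamilton_jacobi // mulr_sumr -sumrMnl.
by apply: eq_bigr => i _; rewrite DX mulrnAl -mulrA -expr2.
Qed.

End InversionPair.
End DeformationParameter.

Theorem corollary2p7 (R : realType) (n : nat)
    (P : {fps R[i][n]}) (Q : {fpst R[i][n]})
    (hP : order_ge 2 P) (hQ : deformed_inversion_pair P Q)
    (k m : nat) (hm : (1 <= m)%N) :
  fpst_deriv_t (iter k (@laplacian n _) (Q ^+ m)) =
    ((2 * m.+1%:R)^-1 : R[i])%:FS *: iter k.+1 (@laplacian n _) (Q ^+ m.+1)
    - (2^-1 : R[i])%:FS *: iter k (@laplacian n _) (Q ^+ m * laplacian Q).
Proof.
have K0 (x : R[i]) l : x *+ l.+1 = 0 -> x = 0.
  by move=> /eqP; rewrite Num.Theory.mulrn_eq0 => /eqP.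
(* All terms are brought under the same k-fold Laplacian, which leaves the case k = 0. *)
rewrite fpst_deriv_t_iter_laplacian iterSr -iter_laplacianB.
congr (iter k _ _); rewrite (laplacianX hQ _ K0).
have scale_nat (c : R[i]) l (f : {fpst R[i][n]}) :
    c%:FS *: (f *+ l) = (c * l%:R)%:FS *: f.
  by rewrite -scaler_nat scalerA rmorphM rmorph_nat.
(* The factor m + 1 from [laplacianX] cancels, so that 1/2 remains on both terms and the two copies
   of Q^m times the Laplacian of Q cancel. *)
rewrite scale_nat invfM mulfVK ?Num.Theory.pnatr_eq0 // scalerDr scale_nat.
by rewrite mulVf ?Num.Theory.pnatr_eq0 // rmorph1 scale1r addrC addKr.
Qed.
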